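(* Let $n,m,k\ge 1$ be integers and let $T:\mathbb{C}^{n\times n}\to\mathbb{C}^{m\times m}$ be a linear map. Then $T$ is $k$-positive if and only if $\langle \mathcal{J}_2(T)v,v\rangle\ge 0$ holds for all vectors $v\in\mathbb{C}^n\otimes\mathbb{C}^m$ having Schmidt number less than or equal to $k$.
   Context: Scalar products $\langle\cdot,\cdot\rangle$ are linear in the left and antilinear in the right argument; $\mathbb{C}^n$, $\mathbb{C}^m$ and $\mathbb{C}^n\otimes\mathbb{C}^m$ carry their standard scalar products. An inequality $\langle Mv,v\rangle\ge 0$ means that the number is real and non-negative. A matrix is called positive if it is positive semidefinite, and a linear map between matrix algebras is called positive if it maps positive matrices to positive matrices. For $k\ge 1$, $M_k(\mathbb{C}^{n\times n})$ denotes the $k\times k$ matrices with entries in $\mathbb{C}^{n\times n}$, identified with the matrices acting on $\mathbb{C}^k\otimes\mathbb{C}^n$. The map $T_k=\mathrm{id}_k\otimes T: M_k(\mathbb{C}^{n\times n})\to M_k(\mathbb{C}^{m\times m})$ is defined by $T_k\big((a_{ij})_{i,j=1}^k\big)=(T(a_{ij}))_{i,j=1}^k$. $T$ is $k$-positive if $T_k$ is positive. Let $E_{ij}\in\mathbb{C}^{n\times n}$ ($1\le i,j\le n$) be the matrix with entry $1$ in row $i$, column $j$ and all other entries $0$. The operator $\mathcal{J}_2(T)\in\mathbb{C}^{n\times n}\otimes\mathbb{C}^{m\times m}$, acting on $\mathbb{C}^n\otimes\mathbb{C}^m$, is defined by $\mathcal{J}_2(T)=\sum_{i,j=1}^n E_{ij}\otimes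 T(E_{ij})$. The Schmidt number of a non-zero vector $v\in\mathbb{C}^n\otimes\mathbb{C}^m$ is the unique $s\in\{1,\dots,\min\{n,m\}\}$ for which there exist positive numbers $\lambda_1,\dots,\lambda_s$ and orthonormal systems $(e_i^A)_{i=1}^s$ in $\mathbb{C}^n$ and $(e_i^B)_{i=1}^s$ in $\mathbb{C}^m$ with $v=\sum_{i=1}^s\lambda_i\, e_i^A\otimes e_i^B$ (Schmidt decomposition). *)

(* Defs.v *)
From mathcomp Require Import all_boot all_order all_algebra.
From mathcomp Require Import complex mxtens.

Set Implicit Arguments.
Unset Strict Implicit.
Unset Printing Implicit Defensive.

Import Order.TTheory GRing.Theory Num.Theory.
Local Open Scope ring_scope.

Section Defs.
Variable C : numClosedFieldType.

(* [dotmx] is linear on the left and antilinear on the right, but it is defined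
   on row vectors; here vectors are columns, on which matrices act by [*m]. *)
Definition inner n (u v : 'cV[C]_n) : C := dotmx u^T v^T.

(* In C, [0 <= z] says that z is real and non-negative; over the complex numbers
   this condition forces A to be Hermitian. *)
Definition psd n (A : 'M[C]_n) : Prop :=
  forall v : 'cV[C]_n, 0 <= inner (A *m v) v.

Definition positive_map p q (Phi : 'M[C]_p -> 'M[C]_q) : Prop :=
  forall A : 'M[C]_p, psd A -> psd (Phi A).

(* C^k (x) C^n is 'cV[C]_(k * n), via the Kronecker product [*t]; the basis
   vector e_i (x) e_a has index [mxtens_index (i, a)].  [flatten_mx] is the
   corresponding identification of a k x k matrix of n x n matrices with a
   matrix acting on C^k (x) C^n, and [blocks_mx] is its inverse. *)
Definition flatten_mx k n (a : 'M['M[C]_n]_k) : 'M[C]_(k * n) :=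
  \sum_(i < k) \sum_(j < k) (delta_mx i j *t a i j).

Definition blocks_mx k n (A : 'M[C]_(k * n)) : 'M['M[C]_n]_k :=
  \matrix_(i < k, j < k) \matrix_(a < n, b < n)
    A (mxtens_index (i, a)) (mxtens_index (j, b)).

Definition ampliation k n m (T : 'M[C]_n -> 'M[C]_m) (A : 'M[C]_(k * n)) :
    'M[C]_(k * m) :=
  flatten_mx (map_mx T (blocks_mx A)).

Definition k_positive k n m (T : 'M[C]_n -> 'M[C]_m) : Prop :=
  positive_map (@ampliation k n m T).

Definition choi n m (T : 'M[C]_n -> 'M[C]_m) : 'M[C]_(n * m) :=
  \sum_(i < n) \sum_(j < n) (delta_mx i j *t T (delta_mx i j)).

Definition orthonormal_system s n (e : 'I_s -> 'cV[C]_n) : Prop :=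
  forall i j : 'I_s, inner (e i) (e j) = (i == j)%:R.

(* The Schmidt number as a relation: s is the Schmidt number of v.  It has no
   Schmidt number when v = 0. *)
Definition is_schmidt_number n m (v : 'cV[C]_(n * m)) (s : nat) : Prop :=
  [/\ v != 0, (1 <= s <= minn n m)%N &
    exists (lambda : 'I_s -> C) (eA : 'I_s -> 'cV[C]_n) (eB : 'I_s -> 'cV[C]_m),
      [/\ forall i, 0 < lambda i, orthonormal_system eA, orthonormal_system eB &
        v = \sum_(i < s) lambda i *: (eA i *t eB i)]].

Lemma flatten_mxE k n (a : 'M['M[C]_n]_k) i j p q :
  flatten_mx a (mxtens_index (i, p)) (mxtens_index (j, q)) = a i j p q.
Proof.
rewrite summxE (bigD1 i) //= summxE (bigD1 j) //= tensmxE mxE !eqxx mul1r.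
rewrite !big1 ?addr0 // => [i' ni | j' nj].
  by rewrite summxE big1 // => j' _; rewrite tensmxE mxE eq_sym (negPf ni) mul0r.
by rewrite tensmxE mxE eqxx eq_sym (negPf nj) mul0r.
Qed.

Lemma flatten_mxK k n : cancel (@flatten_mx k n) (@blocks_mx k n).
Proof.
by move=> a; apply/matrixP=> i j; apply/matrixP=> p q; rewrite !mxE flatten_mxE.
Qed.

Lemma blocks_mxK k n : cancel (@blocks_mx k n) (@flatten_mx k n).
Proof.
move=> A; apply/matrixP=> x y.
case: (mxtens_indexP x) => i p; case: (mxtens_indexP y) => j q.
by rewrite flatten_mxE !mxE.
Qed.

End Defs.

(* Main.v *)
(* Identify vectors of C^n (x) C^m with n x m matrices, so that the Schmidt
   number becomes the rank.  For u and w in C^k (x) C^n and C^k (x) C^m, with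
   matrices X and W, one has <T_k(u u^* )w, w> = <J_2(T)v, v>, where v has
   matrix X^* W.  By the spectral theorem T_k is positive iff it is positive on
   all u u^*, and the matrices X^* W are exactly those of rank at most k. *)
Require Import Defs.
From mathcomp Require Import all_boot all_order all_algebra.
From mathcomp Require Import complex mxtens reals.
From HB Require Import structures.

Import Order.TTheory GRing.Theory Num.Theory.
Local Open Scope ring_scope.

Local Notation "A ^t*" := (map_mx Num.conj (trmx A)) (at level 30) : ring_scope.

Section ChoiPositivity.
Context {C : numClosedFieldType}.

(** * Adjoints and inner products *)

Lemma adjmx_mul {m n p} (A : 'M[C]_(m, n)) (B : 'M[C]_(n, p)) :
  (A *m B)^t* = B^t* *m A^t*.
Proof. by rewrite trmx_mul map_mxM. Qed.

Lemma inner_adjmx {n} (u v : 'cV[C]_n) : inner u v = (v^t* *m u) 0 0.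
Proof.
by rewrite /inner dotmxE !mxE; apply: eq_bigr => i _; rewrite !mxE mulrC.
Qed.

Lemma inner_sum {n} (u v : 'cV[C]_n) :
  inner u v = \sum_i u i 0 * (v i 0)^*.
Proof.
by rewrite inner_adjmx mxE; apply: eq_bigr => i _; rewrite !mxE mulrC.
Qed.

Lemma inner_adjoint {n} (A : 'M[C]_n) (u v : 'cV[C]_n) :
  inner (A^t* *m u) v = (inner (A *m v) u)^*.
Proof.
have -> : (inner (A *m v) u)^* = ((u^t* *m (A *m v))^t*) 0 0.
  by rewrite inner_adjmx !mxE.
by rewrite inner_adjmx !adjmx_mul trmxCK mulmxA.
Qed.

(** * Positive semidefinite matrices and the spectral theorem *)

Lemma psd_sum {n} {I : finType} (A : I -> 'M[C]_n) :
  (forall i, psd (A i)) -> psd (\sum_i A i).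
Proof.
move=> psdA v; rewrite inner_adjmx mulmx_suml mulmx_sumr summxE.
by apply: sumr_ge0 => i _; rewrite -inner_adjmx psdA.
Qed.

Lemma psd_scale {n} (c : C) (A : 'M[C]_n) : 0 <= c -> psd A -> psd (c *: A).
Proof.
move=> c_ge0 psdA v.
by rewrite inner_adjmx -scalemxAl -scalemxAr mxE -inner_adjmx mulr_ge0.
Qed.

Lemma psd_rank1 {n} (u : 'cV[C]_n) : psd (u *m u^t*).
Proof.
move=> v; rewrite inner_adjmx -mulmxA mulmxA mxE big_ord1.
(* The form is now [(v^t* *m u) 0 0] times [(u^t* *m v) 0 0], a number times its conjugate. *)
have -> : (v^t* *m u) 0 0 = ((u^t* *m v) 0 0)^*.
  rewrite -!inner_adjmx !inner_sum rmorph_sum; apply: eq_bigr => i _.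
  by rewrite rmorphM /= conjCK mulrC.
by rewrite mulrC mul_conjC_ge0.
Qed.

Lemma spectralE {n} {A : 'M[C]_n} (P := spectralmx A) : A \is normalmx ->
  A = P^t* *m diag_mx (spectral_diag A) *m P.
Proof.
by move=> /orthomx_spectralP {1}->; rewrite invmx_unitary ?spectral_unitarymx.
Qed.

Lemma spectral_diagE {n} {A : 'M[C]_n} (P := spectralmx A) : A \is normalmx ->
  P *m A *m P^t* = diag_mx (spectral_diag A).
Proof.
move=> nA; have /unitarymxP PP := spectral_unitarymx A.
transitivity (P *m (P^t* *m diag_mx (spectral_diag A) *m P) *m P^t*).
  by congr (_ *m _ *m _); exact: spectralE.
by rewrite !mulmxA PP mul1mx -mulmxA PP mulmx1.
Qed.

(** Lets vanishing or non-negativity of the quadratic form pass to the eigenvalues: [u] is the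
    eigenvector belonging to the [i]-th one. *)
Lemma spectral_diag_inner {n} {A : 'M[C]_n} (i : 'I_n)
    (u := (row i (spectralmx A))^t*) :
  A \is normalmx -> spectral_diag A 0 i = inner (A *m u) u.
Proof.
move=> /spectral_diagE /matrixP /(_ i i); rewrite [RHS]mxE eqxx mulr1n => <-.
rewrite inner_adjmx /u trmxCK mulmxA.
rewrite [LHS]mxE [RHS]mxE; apply: eq_bigr => j _.
by rewrite -row_mul !mxE.
Qed.

(* The anti-Hermitian part of [A] is normal with vanishing quadratic form, so
   all its eigenvalues vanish. *)
Lemma psd_normal {n} {A : 'M[C]_n} : psd A -> A \is normalmx.
Proof.
move=> psdA; pose B := A - A^t*.
have adjB : B^t* = - B by rewrite /B linearB map_mxB trmxCK opprB.
have nB : B \is normalmx by apply/normalmxP; rewrite adjB mulmxN mulNmx.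
have B0 : B = 0.
  rewrite (spectralE nB); suff -> : spectral_diag B = 0.
    by rewrite linear0 mulmx0 mul0mx.
  apply/rowP => i; rewrite spectral_diag_inner // mxE.
  set u := _^t*; have Auu := psdA u.
  rewrite inner_adjmx mulmxBl mulmxBr [LHS]mxE [X in _ + X]mxE -!inner_adjmx inner_adjoint.
  by rewrite (CrealP (ger0_real Auu)) subrr.
apply/normalmxP; move/eqP: B0; rewrite subr_eq0 => /eqP {2 3}->.
by rewrite trmxCK.
Qed.

Lemma psd_decomposition {n} {A : 'M[C]_n} : psd A ->
  exists (d : 'I_n -> C) (u : 'I_n -> 'cV[C]_n),
    (forall i, 0 <= d i) /\ A = \sum_i d i *: (u i *m (u i)^t*).
Proof.
move=> psdA; have nA := psd_normal psdA.
exists (spectral_diag A 0), (fun i => (row i (spectralmx A))^t*); split.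
  by move=> i; rewrite spectral_diag_inner.
rewrite {1}(spectralE nA) -mulmxA mul_diag_mx; apply/matrixP => a b.
rewrite mxE summxE; apply: eq_bigr => i _.
by rewrite [RHS]mxE [X in _ = _ * X]mxE big_ord1 !mxE conjCK mulrCA.
Qed.

(** * Vectors of a tensor product as matrices *)

Definition tens_of_mx {n m} (V : 'M[C]_(n, m)) : 'cV[C]_(n * m) :=
  \col_x V (mxtens_unindex x).1 (mxtens_unindex x).2.

Definition mx_of_tens {n m} (v : 'cV[C]_(n * m)) : 'M[C]_(n, m) :=
  \matrix_(i, j) v (mxtens_index (i, j)) 0.

Lemma tens_of_mxE {n m} (V : 'M[C]_(n, m)) i j l :
  tens_of_mx V (mxtens_index (i, j)) l = V i j.
Proof. by rewrite mxE mxtens_indexK. Qed.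

Lemma mx_of_tensK {n m} : cancel (@mx_of_tens n m) (@tens_of_mx n m).
Proof.
move=> v; apply/colP => x; case: (mxtens_indexP x) => i j.
by rewrite tens_of_mxE mxE.
Qed.

Lemma sum_mxtens_index {n m} (F : 'I_(n * m) -> C) :
  \sum_x F x = \sum_i \sum_j F (mxtens_index (i, j)).
Proof.
rewrite pair_big /= (reindex (@mxtens_index n m)) /=.
  by apply: eq_bigr => -[].
by exists (@mxtens_unindex n m) => x _; rewrite ?mxtens_indexK ?mxtens_unindexK.
Qed.

(** The sum over blocks is kept innermost: for blocks [T (b i j)] and fixed [p], [q], linearity then
    gathers it into a single value of [T]. *)
Lemma inner_flatten_mx {k m} (a : 'M['M[C]_m]_k) (W : 'M[C]_(k, m)) :
  inner (flatten_mx a *m tens_of_mx W) (tens_of_mx W) =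
  \sum_p \sum_q (\sum_i \sum_j (W j q * (W i p)^*) *: a i j) p q.
Proof.
rewrite inner_sum sum_mxtens_index exchange_big; apply: eq_bigr => p _ /=.
transitivity (\sum_i \sum_q \sum_j (W j q * (W i p)^*) * a i j p q).
  apply: eq_bigr => i _; rewrite mxE sum_mxtens_index exchange_big /= mulr_suml.
  apply: eq_bigr => q _; rewrite mulr_suml; apply: eq_bigr => j _.
  by rewrite flatten_mxE !tens_of_mxE -mulrA mulrC.
rewrite exchange_big; apply: eq_bigr => q _; rewrite summxE.
by apply: eq_bigr => i _; rewrite summxE; apply: eq_bigr => j _; rewrite mxE.
Qed.

(** * Quadratic forms of the ampliation and of the Choi matrix *)

Section LinearMap.
Variables (n m : nat) (T : {linear 'M[C]_n -> 'M[C]_m}).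

Lemma inner_flatten_map {k} (b : 'M['M[C]_n]_k) (W : 'M[C]_(k, m)) :
  inner (flatten_mx (map_mx T b) *m tens_of_mx W) (tens_of_mx W) =
  \sum_p \sum_q T (\sum_i \sum_j (W j q * (W i p)^*) *: b i j) p q.
Proof.
rewrite inner_flatten_mx; apply: eq_bigr => p _; apply: eq_bigr => q _.
congr ((_ : 'M_m) p q); rewrite linear_sum; apply: eq_bigr => i _.
by rewrite linear_sum; apply: eq_bigr => j _; rewrite linearZ mxE.
Qed.

Lemma inner_choi (V : 'M[C]_(n, m)) :
  inner (choi T *m tens_of_mx V) (tens_of_mx V) =
  \sum_p \sum_q T (\matrix_(a, b) (V b q * (V a p)^*)) p q.
Proof.
(* The Choi matrix has the blocks [T (delta_mx i j)]; a combination of matrix units is the matrix of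
   its coefficients. *)
have -> : choi T = flatten_mx (map_mx T (\matrix_(i, j) delta_mx i j)).
  by apply: eq_bigr => i _; apply: eq_bigr => j _; rewrite !mxE.
rewrite inner_flatten_map; apply: eq_bigr => p _; apply: eq_bigr => q _.
congr ((T _ : 'M_m) p q); rewrite [RHS]matrix_sum_delta.
by apply: eq_bigr => i _; apply: eq_bigr => j _; rewrite !mxE.
Qed.

(** Both sides evaluate [T] at the same matrices. Block [(i, j)] of [u *m u^t*] has entries
    [X i a * (X j b)^*]; weighted by [W j q * (W i p)^*], the double sum over [i], [j] splits into
    [V b q] times [(V a p)^*]. *)
Lemma inner_ampliation_rank1 {k} (X : 'M[C]_(k, n)) (W : 'M[C]_(k, m))
    (u := tens_of_mx X) (V := X^t* *m W) :
  inner (ampliation T (u *m u^t*) *m tens_of_mx W) (tens_of_mx W) =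
  inner (choi T *m tens_of_mx V) (tens_of_mx V).
Proof.
rewrite inner_flatten_map inner_choi.
apply: eq_bigr => p _; apply: eq_bigr => q _; congr ((T _ : 'M_m) p q).
apply/matrixP => a b; rewrite summxE !mxE rmorph_sum mulr_sumr.
apply: eq_bigr => i _; rewrite summxE mulr_suml; apply: eq_bigr => j _.
rewrite !mxE big_ord1 !mxE !mxtens_indexK /= rmorphM /= conjCK.
by rewrite [RHS]mulrACA [RHS]mulrC [(X j b)^* * _]mulrC.
Qed.

(** Allows the ampliation to be applied termwise to a spectral sum. *)
Lemma ampliation_linear k : linear (@ampliation C k n m T).
Proof.
move=> c A B; apply/matrixP => x y.
case: (mxtens_indexP x) => i p; case: (mxtens_indexP y) => j q.
rewrite [RHS]mxE [X in _ = X + _]mxE !flatten_mxE !mxE.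
have -> : \matrix_(a < n, b < n)
    (c *: A + B) (mxtens_index (i, a)) (mxtens_index (j, b)) =
  c *: (\matrix_(a < n, b < n) A (mxtens_index (i, a)) (mxtens_index (j, b)))
  + \matrix_(a < n, b < n) B (mxtens_index (i, a)) (mxtens_index (j, b)).
  by apply/matrixP => a b; rewrite !mxE.
by rewrite linearP 2!mxE.
Qed.

HB.instance Definition _ k :=
  GRing.isLinear.Build C _ _ _ (@ampliation C k n m T) (ampliation_linear k).

Lemma mxrank_factor {k} {V : 'M[C]_(n, m)} : (\rank V <= k)%N ->
  exists (X : 'M[C]_(n, k)) (Y : 'M[C]_(k, m)), V = X *m Y.
Proof.
(* The rank factorisation [col_base V *m row_base V] is padded with zeros to inner dimension exactly
   [k]. *)
move=> rVk; exists (col_base V *m pid_mx (\rank V)).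
exists (pid_mx (\rank V) *m row_base V).
by rewrite mulmxA -(mulmxA (col_base V)) pid_mx_id // pid_mx_1 mulmx1 mulmx_base.
Qed.

Lemma k_positive_rank k : k_positive k T <->
  (forall V : 'M[C]_(n, m), (\rank V <= k)%N ->
     0 <= inner (choi T *m tens_of_mx V) (tens_of_mx V)).
Proof.
split=> [Tpos V /mxrank_factor[X [Y ->]] | choi_ge0 A /psd_decomposition].
  (* The left factor is read as an adjoint, so [X^t*] becomes the matrix of [u] and [Y] that of
     [w]. *)
  rewrite -[X]trmxCK -inner_ampliation_rank1.
  exact/Tpos/psd_rank1.
case=> d [u [d_ge0 ->]]; rewrite linear_sum /=.
apply: psd_sum => x; rewrite linearZ; apply: psd_scale => // w.
(* The matrices of [u x] and [w] have [k] rows, so the resulting product factors through dimension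
   [k]. *)
rewrite -[w]mx_of_tensK -[u x]mx_of_tensK inner_ampliation_rank1.
apply: choi_ge0; exact: leq_trans (mxrankM_maxl _ _) (rank_leq_col _).
Qed.

End LinearMap.

(** * Schmidt number and rank *)

Lemma rank_schmidt {n m} {v : 'cV[C]_(n * m)} {s} :
  is_schmidt_number v s -> (\rank (mx_of_tens v) <= s)%N.
Proof.
case=> _ _ [lambda [eA [eB [_ _ _ ->]]]].
(* With the coefficients absorbed into the left factor, the inner dimension [s] bounds the rank. *)
pose X := \matrix_(a < n, i < s) (lambda i * eA i a 0).
pose Y := \matrix_(i < s, p < m) eB i p 0.
suff -> : mx_of_tens (\sum_(i < s) lambda i *: (eA i *t eB i)) = X *m Y.
  exact: leq_trans (mxrankM_maxr _ _) (rank_leq_row _).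
apply/matrixP => a p; rewrite !mxE summxE; apply: eq_bigr => i _.
rewrite !mxE mxtens_indexK /= -mulrA; congr (_ * (eA i a _ * eB i p _)).
  exact: ord1.
exact: ord1.
Qed.

(* Diagonalising [V V*] by a unitary [P] makes the rows of [U = P V] orthogonal,
   and [V = P* U] is the Schmidt decomposition once the zero rows are dropped. *)
Lemma schmidt_decomposition {n m} {V : 'M[C]_(n, m)} : V != 0 ->
  exists2 s, is_schmidt_number (tens_of_mx V) s & (s <= \rank V)%N.
Proof.
move=> V_neq0; pose G := V *m V^t*; pose P := spectralmx G; pose U := P *m V.
pose d := spectral_diag G 0.
have nG : G \is normalmx.
  by apply/normalmxP; rewrite /G adjmx_mul trmxCK.
have PP : P *m P^t* = 1%:M by apply/unitarymxP/spectral_unitarymx.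
have PP' : P^t* *m P = 1%:M by apply: mulmx1C.
have UU i j : \sum_p U i p * (U j p)^* = d i *+ (i == j).
  have := spectral_diagE nG; rewrite -/P -/d /G => /matrixP/(_ i j).
  rewrite [RHS]mxE => <-; rewrite mulmxA -/U -mulmxA -adjmx_mul -/U mxE.
  by apply: eq_bigr => p _; rewrite !mxE.
have d_ge0 i : 0 <= d i.
  have := UU i i; rewrite eqxx mulr1n => <-.
  by apply: sumr_ge0 => p _; apply: mul_conjC_ge0.
have U0 i p : d i = 0 -> U i p = 0.
  move=> di0; have /eqP := UU i i; rewrite eqxx mulr1n di0.
  rewrite psumr_eq0 => [/allP/(_ p)|q _]; last exact: mul_conjC_ge0.
  by rewrite mem_index_enum => /(_ isT); rewrite /= mul_conjC_eq0 => /eqP.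
pose S := [pred i | d i != 0]; pose f : 'I_#|S| -> 'I_n := enum_val.
have f_neq0 i : d (f i) != 0 by have := enum_valP i.
have f_inj i j : (f i == f j) = (i == j) by apply: inj_eq; exact: enum_val_inj.
have VE a p : V a p = \sum_(i < #|S|) (P (f i) a)^* * U (f i) p.
  have -> : V = P^t* *m U by rewrite /U mulmxA PP' mul1mx.
  rewrite mxE -(@big_enum_val _ _ _ _ S (fun i => (P i a)^* * U i p)) /=.
  rewrite [RHS]big_mkcond; apply: eq_bigr => i _; rewrite inE.
  case: eqP => /= [/U0 ->|_]; first by rewrite mulr0.
  by congr (_ * _); rewrite !mxE.
(* The Gram matrix of the kept rows is diagonal with non-zero entries, hence invertible; these rows
   form a product with right factor [V]. *)
have rankS : (#|S| <= \rank V)%N.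
  have -> : #|S| = \rank (rowsub f U *m (rowsub f U)^t*).
    have -> : rowsub f U *m (rowsub f U)^t* = diag_mx (\row_i d (f i)).
      apply/matrixP => i j; rewrite !mxE -f_inj; case: eqP => [fij|/eqP/negPf fij].
        have := UU (f i) (f j); rewrite fij eqxx => <-.
        by apply: eq_bigr => p _; rewrite !mxE fij.
      have := UU (f i) (f j); rewrite fij => <-.
      by apply: eq_bigr => p _; rewrite !mxE.
    apply/esym/mxrank_unit; rewrite unitmxE det_diag unitfE.
    by apply/prodf_neq0 => i _; rewrite mxE.
  rewrite (leq_trans (mxrankM_maxl _ _)) // -mul_rowsub_mx.
  exact: mxrankM_maxr.
exists #|S| => //; split.
- apply: contraNneq V_neq0 => V0; apply/eqP/matrixP => a p.
  by rewrite -(tens_of_mxE V a p 0) V0 !mxE.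
- apply/andP; split; last first.
    by rewrite (leq_trans rankS) // leq_min rank_leq_row rank_leq_col.
  rewrite lt0n; apply: contraNneq V_neq0 => S0; apply/eqP/matrixP => a p.
  by rewrite VE mxE big1 // => i; have := leq_ltn_trans (leq0n i) (ltn_ord i); rewrite S0.
(* These are the non-zero singular values of [V]: [d (f i)] is the squared norm of row [f i] of
   [U]. *)
pose lam i := sqrtC (d (f i)).
have lam_gt0 i : 0 < lam i by rewrite sqrtC_gt0 lt_def f_neq0 d_ge0.
(* Rows of [P] are conjugated because [V = P^t* *m U]; rows of [U] are only transposed, since
   [x *t y] has matrix [x *m y^T]. *)
exists lam, (fun i => (row (f i) P)^t*), (fun i => (lam i)^-1 *: (row (f i) U)^T).
split=> // [i j|i j|].
(* Conjugating the rows of [P] swaps the two arguments of the inner product, hence the entry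
   [(f j, f i)]. *)
- have /matrixP/(_ (f j) (f i)) := PP; rewrite [RHS]mxE f_inj eq_sym => <-.
  rewrite inner_sum mxE; apply: eq_bigr => a _.
  by rewrite !mxE conjCK mulrC.
- rewrite inner_sum; transitivity ((lam i)^-1 * (lam j)^-1 * (d (f i) *+ (f i == f j))).
    rewrite -UU mulr_sumr; apply: eq_bigr => p _; rewrite !mxE rmorphM fmorphV /=.
    by rewrite (CrealP (gtr0_real (lam_gt0 j))) mulrACA.
  rewrite f_inj; case: eqP => [->|_]; last by rewrite mulr0.
  by rewrite mulr1n -invfM -expr2 sqrtCK mulVf.
- apply/colP => x; case: (mxtens_indexP x) => a p.
  rewrite tens_of_mxE VE summxE; apply: eq_bigr => i _.
  rewrite !mxE !mxtens_indexK mulrCA; congr (_ * _).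
  by rewrite mulrA divff ?mul1r // gt_eqF.
Qed.

End ChoiPositivity.

Theorem theorem3 (R : realType) (n m k : nat)
    (n_ge1 : (1 <= n)%N) (m_ge1 : (1 <= m)%N) (k_ge1 : (1 <= k)%N)
    (T : {linear 'M[R[i]]_n -> 'M[R[i]]_m}) :
  k_positive k T <->
  (forall (v : 'cV[R[i]]_(n * m)) (s : nat),
     is_schmidt_number v s -> (s <= k)%N -> 0 <= inner (choi T *m v) v).
Proof.
rewrite k_positive_rank; split=> [choi_ge0 v s vs sk | choi_ge0 V Vk].
  rewrite -[v]mx_of_tensK; apply: choi_ge0.
  exact: leq_trans (rank_schmidt vs) sk.
(* The zero vector has no Schmidt number, so the hypothesis says nothing about it; its form is
   zero. *)
have [-> | V_neq0] := eqVneq V 0.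
  rewrite inner_choi big1 // => p _; rewrite big1 // => q _.
  have -> : \matrix_(a, b) ((0 : 'M[R[i]]_(n, m)) b q * ((0 : 'M[R[i]]_(n, m)) a p)^*) = 0.
    by apply/matrixP => a b; rewrite !mxE mul0r.
  by rewrite linear0 mxE.
have [s Vs sV] := schmidt_decomposition V_neq0.
exact: choi_ge0 Vs (leq_trans sV Vk).
Qed.
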